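(* Let $k$ be a field of characteristic zero and ${\boldsymbol\lambda}=(\lambda_{ij}),{\boldsymbol\mu}\in M_n(k)$ antisymmetric, and assume one of the following: (a) ${\boldsymbol\lambda}\in GL_n(k)$; (b) the subgroup $\sum_{i,j=1}^n\mathbb Z\lambda_{ij}$ of $(k,+)$ is cyclic; (c) the subgroup $\sum_{i,j=1}^n\mathbb Z\lambda_{ij}$ of $(k,+)$ is free abelian of rank $n(n-1)/2$. Then $k_{\boldsymbol\lambda}(x_1,\dots,x_n)\cong k_{\boldsymbol\mu}(x_1,\dots,x_n)$ as Poisson algebras over $k$ if and only if there exists $A\in GL_n(\mathbb Z)$ with ${\boldsymbol\mu}=A{\boldsymbol\lambda}A^{\mathrm{tr}}$.
   Context: For antisymmetric ${\boldsymbol\lambda}\in M_n(k)$, $k_{\boldsymbol\lambda}(x_1,\dots,x_n)$ is the rational function field $k(x_1,\dots,x_n)$ with the unique Poisson bracket satisfying $\{x_i,x_j\}=\lambda_{ij}x_ix_j$ for all $i,j$. *)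

(* Defs.v *)
From HB Require Import structures.
From mathcomp Require Import all_boot all_order all_algebra.
From mathcomp Require Import fraction.
From mathcomp.multinomials Require Import mpoly.
Set Implicit Arguments. Unset Strict Implicit. Unset Printing Implicit Defensive.
Import Order.TTheory GRing.Theory Num.Theory.
Local Open Scope ring_scope.

Definition ratfun (k : fieldType) (n : nat) := {fraction {mpoly k[n]}}.

Definition rvar (k : fieldType) (n : nat) (i : 'I_n) : ratfun k n :=
  tofrac ('X_i : {mpoly k[n]}).
Definition rconst (k : fieldType) (n : nat) (c : k) : ratfun k n :=
  tofrac (c%:MP : {mpoly k[n]}).

(* Partial derivative d/dx_i on k(x_1,...,x_n), computed via the quotient rule
   on a representative fraction a/b (the result does not depend on it). *)
Definition rderiv (k : fieldType) (n : nat) (i : 'I_n) (f : ratfun k n)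
  : ratfun k n :=
  let r := repr f in
  let a := (frac r).1 in let b := (frac r).2 in
  tofrac (mderiv i a * b - a * mderiv i b) / tofrac (b * b).

(* The Poisson bracket of k_lambda(x_1,...,x_n): the unique biderivation with
   {x_i, x_j} = lambda_ij x_i x_j, i.e.
   {f, g} = sum_{i,j} lambda_ij x_i x_j (df/dx_i) (dg/dx_j). *)
Definition pbracket (k : fieldType) (n : nat) (lam : 'M[k]_n)
  (f g : ratfun k n) : ratfun k n :=
  \sum_(i < n) \sum_(j < n)
    @rconst k n (lam i j) * @rvar k n i * @rvar k n j * rderiv i f * rderiv j g.

Definition poisson_iso (k : fieldType) (n : nat) (lam mu : 'M[k]_n) : Prop :=
  exists phi : {rmorphism ratfun k n -> ratfun k n},
    [/\ bijective phi,
        (forall c : k, phi (@rconst k n c) = @rconst k n c) &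
        (forall f g, phi (pbracket lam f g) = pbracket mu (phi f) (phi g))].

Definition entry_subgroup (k : fieldType) (n : nat) (lam : 'M[k]_n) (x : k)
  : Prop :=
  exists m : 'I_n -> 'I_n -> int, x = \sum_(i < n) \sum_(j < n) lam i j *~ m i j.

Definition cyclic_subgroup (k : fieldType) (G : k -> Prop) : Prop :=
  exists c : k, forall x, G x <-> exists z : int, x = c *~ z.

Definition free_abelian_rank (k : fieldType) (G : k -> Prop) (r : nat) : Prop :=
  exists b : 'I_r -> k,
    (forall z : 'I_r -> int, \sum_(l < r) b l *~ z l = 0 -> forall l, z l = 0) /\
    (forall x, G x <-> exists z : 'I_r -> int, x = \sum_(l < r) b l *~ z l).

Definition antisym (k : fieldType) (n : nat) (lam : 'M[k]_n) : Prop :=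
  lam^T = - lam.

Definition intmx (k : fieldType) (n : nat) (A : 'M[int]_n) : 'M[k]_n :=
  map_mx (fun z : int => z%:~R) A.

(* Main.v *)
Require Import Defs.
From HB Require Import structures.
From mathcomp Require Import all_boot all_order all_algebra.
From mathcomp Require Import fraction.
From mathcomp.multinomials Require Import mpoly.
From mathcomp Require Import generic_quotient ring.
Import Order.TTheory GRing.Theory Num.Theory.
Local Open Scope ring_scope.
Set Implicit Arguments.
Unset Strict Implicit.
Unset Printing Implicit Defensive.

(** The leading monomial defines a valuation on [k(x_1,...,x_n)] with values
in [Z^n] and residue field [k], and [x_l (df/dx_l) / f] has residue the [l]-th
coordinate of the leading exponent of [f].  If [{y_i, y_j} = lam_ij y_i y_j]
for the bracket of [mu], dividing by [y_i y_j] and taking residues gives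
[lam = A mu A^T], where the rows of the integer matrix [A] are the leading
exponents of the [y_i].  An isomorphism and its inverse therefore yield integer
matrices with [lam = A mu A^T] and [mu = B lam B^T], so that [C = A B] is an
isometry of [lam].  In case (a), [det C = 1] or [-1].  In case (b), [lam] is a
multiple of an integer matrix and, after splitting off the radicals of [lam]
and [mu] by a unimodular change of basis, case (a) applies to the nondegenerate
blocks.  In case (c), the entries of [lam] above the diagonal are linearly
independent over [Z], so all 2x2 minors of [C] agree with those of the identity
and [C] is invertible.  Conversely, [A] in [GL_n(Z)] gives the automorphism
sending [x_i] to the Laurent monomial with exponent the [i]-th row of
[A^-1]. *)

(** * Congruence of integer matrices *)

Lemma intr_inj_pchar0 (R : idomainType) :
  [pchar R] =i pred0 -> injective (intr : int -> R).
Proof.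
move=> /pcharf0P char0; apply: raddf_inj => z /=.
rewrite -[z]intz; case: (intP z) => // m /eqP; rewrite ?intz ?rmorphN /= ?oppr_eq0.
  by rewrite (char0 m.+1).
by rewrite (char0 m.+1).
Qed.

Lemma unitmx_mulr (R : comUnitRingType) n (A B : 'M[R]_n) :
  A *m B \in unitmx -> B \in unitmx.
Proof. by rewrite unitmx_mul => /andP[]. Qed.

(** Taking determinants and cancelling [\det L] gives [\det C * \det C = 1] in [R]; injectivity of
    [intr] brings this equation back to the integers. *)
Lemma unitmx_isometry (R : idomainType) n (L : 'M[R]_n) (C : 'M[int]_n) :
  injective (intr : int -> R) -> \det L != 0 ->
  L = map_mx intr C *m L *m (map_mx intr C)^T -> C \in unitmx.
Proof.
move=> intrI nzL /(congr1 determinant).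
rewrite !det_mulmx det_tr det_map_mx mulrAC -{1}[\det L]mul1r => /(mulIf nzL).
rewrite -intrM -[1]/(1%:~R) => /intrI eq1.
by rewrite unitmxE; apply/unitrP; exists (\det C); rewrite -eq1.
Qed.

Lemma mul_row_pid (R : pzRingType) n r (v : 'rV[R]_n) j :
  (v *m pid_mx r) 0 j = v 0 j *+ (j < r)%N.
Proof.
rewrite mxE (bigD1 j) //= mxE eqxx /= big1 ?addr0.
  by case: (_ < _)%N; rewrite ?mulr1 ?mulr0.
by move=> i ij; rewrite mxE (negbTE (_ : i != j :> nat)) ?mulr0.
Qed.

(* The first rows of the left Smith transform span a complement of the
   radical of the alternating form M. *)
Lemma alternating_split_radical n (M : 'M[int]_n) : M^T = - M ->
  exists (U : 'M[int]_n) (r : nat), let N := U *m M *m U^T in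
  [/\ U \in unitmx, (r <= n)%N, N = pid_mx r *m N *m pid_mx r
    & \det (N + copid_mx r) != 0].
Proof.
move=> skewM; have [L Lu [R Ru [d sd defM]]] := int_Smith_normal_form M.
set D := \matrix_(i, j) _ in defM.
(* [f] is the position of the first zero invariant factor, and divisibility makes all later ones
   zero. The minimum with [n] is taken because nothing bounds the length of [d]. *)
pose f := find (pred1 0) d; pose r := minn f n.
have d0 i : (d`_i == 0) = (f <= i)%N.
  case: leqP => [le_fi | lt_if]; last by have := before_find 0 lt_if.
  have [lt_is | le_si] := ltnP i (size d); last by rewrite nth_default.
  have lt_fs : (f < size d)%N by apply: leq_ltn_trans lt_is.
  have df0 : d`_f = 0.
    by have /(nth_find 0)/eqP : has (pred1 0) d by rewrite has_find.
  have := sorted_leq_nth dvdz_trans dvdzz 0 sd f i lt_fs lt_is le_fi.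
  by rewrite df0 dvd0z.
have lt_r (i : 'I_n) : (i < r)%N = (i < f)%N by rewrite leq_min ltn_ord andbT.
pose U := invmx L; exists U, r => N.
have Uu : U \in unitmx by rewrite unitmx_inv.
have skewN : N^T = - N.
  by rewrite !trmx_mul trmxK skewM mulNmx mulmxN mulmxA.
have defN : N = D *m (R *m U^T).
  by rewrite /N defM -[L *m D *m R]mulmxA mulKmx // mulmxA.
have PD : pid_mx r *m D = D.
  apply/row_matrixP => i; rewrite row_mul -[row i D]mul1mx; apply/rowP => j.
  rewrite !mxE big_ord1 !mxE eqxx mul1r (bigD1 i) //= !mxE eqxx /= lt_r ltnNge -d0.
  rewrite big1 ?addr0; first by case: eqP => [->|]; rewrite ?mul0r ?mul0rn ?mul1r.
  by move=> l /negbTE il; rewrite !mxE (_ : (i == l :> nat) = false) ?mul0r // eq_sym.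
(* The rows of [N] from index [r] on vanish because those of [D] do; antisymmetry then gives the
   same for the columns. *)
have PN : pid_mx r *m N = N by rewrite defN mulmxA PD.
have NP : N *m pid_mx r = N.
  apply: trmx_inj; rewrite trmx_mul tr_pid_mx skewN mulmxN PN //.
clearbody N; have NQ : N *m copid_mx r = 0 by rewrite mulmxBr mulmx1 NP subrr.
split=> //; first exact: geq_minr.
  by rewrite PN NP.
(* Multiplying by the complementary projector shows that a kernel vector [v] has no coordinates from
   [r] on. Then [v *m N = 0], and cancelling the invertible [R *m U^T] leaves [v *m D = 0], which
   kills the first [r] coordinates since their invariant factors are nonzero. *)
apply/negP => /det0P[v nzv]; rewrite mulmxDr => vN0.
have vP : v *m copid_mx r = 0.
  have := congr1 (mulmx^~ (copid_mx r)) vN0.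
  rewrite mulmxDl mul0mx -!mulmxA copid_mx_id ?geq_minr //.
  by rewrite NQ mulmx0 add0r.
case/negP: nzv; apply/eqP; rewrite vP addr0 defN in vN0.
have vD0 : v *m D = 0.
  have RUu : R *m U^T \in unitmx by rewrite unitmx_mul Ru unitmx_tr.
  by rewrite -(mulmxK RUu (v *m D)) -[v *m D *m _]mulmxA vN0 mul0mx.
have vPv : v = v *m pid_mx r.
  by apply/eqP; rewrite -subr_eq0 -{1}[v]mulmx1 -mulmxBr vP.
rewrite vPv; apply/rowP => j; rewrite mul_row_pid lt_r mxE.
case: ltnP => // lt_jf; rewrite mulr1n; apply/eqP.
have := congr1 (fun w : 'rV__ => w 0 j) vD0; rewrite !mxE (bigD1 j) //= mxE eqxx.
rewrite big1 ?addr0 => [/eqP|i ij].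
  by rewrite mulf_eq0 mulr1n d0 leqNgt lt_jf orbF.
by rewrite mxE (negbTE (_ : i != j :> nat)) ?mulr0.
Qed.

(** The support of [N] bounds the rank above by [r]; full rank of the sum with a projector of rank
    [n - r] bounds it below. Two forms that are congruent to each other thus have blocks of the same
    size. *)
Lemma rank_split_radical n (N : 'M[int]_n) r : (r <= n)%N ->
  N = pid_mx r *m N *m pid_mx r -> \det (N + copid_mx r) != 0 ->
  \rank (map_mx intr N : 'M[rat]_n) = r.
Proof.
move=> le_rn defN; set N' := map_mx _ _; rewrite -(intr_eq0 rat) -det_map_mx.
rewrite -unitfE -unitmxE -row_full_unit /row_full map_mxD map_copid_mx -/N' => /eqP rkn.
apply/eqP; rewrite eqn_leq; apply/andP; split.
  rewrite /N' defN !map_mxM map_pid_mx; apply: leq_trans (mxrankM_maxr _ _) _.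
  by rewrite rank_pid_mx.
have := mxrank_add N' (copid_mx r); rewrite rkn rank_copid_mx //.
by rewrite addnC -leq_subLR subKn.
Qed.

(** In bases adapted to the radicals both forms live on leading blocks, of equal size because the
    ranks agree. On these blocks the forms are nondegenerate, so the determinant argument applies,
    and the identity on the complement extends the result. *)
Lemma congruence_of_mutual_int n (L M A B : 'M[int]_n) : L^T = - L ->
  L = A *m M *m A^T -> M = B *m L *m B^T ->
  exists2 C : 'M[int]_n, C \in unitmx & M = C *m L *m C^T.
Proof.
move=> skewL defL defM.
have skewM : M^T = - M by rewrite defM !trmx_mul trmxK skewL mulNmx mulmxN mulmxA.
have [U [r []]] := alternating_split_radical skewL.
have [W [s []]] := alternating_split_radical skewM.
set M0 := W *m M *m W^T; set L0 := U *m L *m U^T => Wu le_sn PM nzM Uu le_rn PL nzL.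
pose A0 := U *m A *m invmx W; pose B0 := W *m B *m invmx U.
have conjK (V X : 'M[int]_n) : V \in unitmx -> invmx V *m (V *m X *m V^T) *m (invmx
  V)^T = X.
  by move=> Vu; rewrite -!mulmxA mulKmx // -trmx_mul mulVmx // trmx1 mulmx1.
have defL0 : L0 = A0 *m M0 *m A0^T.
  by rewrite /A0 /L0 {1}defL -{1}(conjK W M) // !trmx_mul !mulmxA.
have defM0 : M0 = B0 *m L0 *m B0^T.
  by rewrite /B0 /M0 {1}defM -{1}(conjK U L) // !trmx_mul !mulmxA.
have eq_rs : r = s.
  rewrite -(rank_split_radical le_rn PL nzL) -(rank_split_radical le_sn PM nzM).
  apply/eqP; rewrite eqn_leq; apply/andP; split; [rewrite defL0|rewrite defM0];
  by rewrite !map_mxM -mulmxA (leq_trans (mxrankM_maxr _ _)) // mxrankM_maxl.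
subst s; pose P : 'M[int]_n := pid_mx r; pose Q : 'M[int]_n := copid_mx r.
have PP : P *m P = P by rewrite pid_mx_id.
have QQ : Q *m Q = Q by rewrite copid_mx_id.
have PQ : P *m Q = 0 by rewrite /Q mulmxBr mulmx1 PP subrr.
have QP : Q *m P = 0 by rewrite /Q mulmxBl mul1mx PP subrr.
have tP : P^T = P by rewrite tr_pid_mx.
have tQ : Q^T = Q by rewrite /Q raddfB /= trmx1 tP.
rewrite -/P -/Q in PL PM nzL; clearbody P Q.
have tE Z : (P *m Z *m P + Q)^T = P *m Z^T *m P + Q.
  by rewrite raddfD /= !trmx_mul tP tQ mulmxA.
(* The congruence is compressed to the leading block and completed by the identity on the
   complement, so that the nondegenerate [L0 + Q] and [M0 + Q] can replace [L0] and [M0]. *)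
have cut X Y Z : X = P *m X *m P -> Y = P *m Y *m P -> X = Z *m Y *m Z^T ->
    X + Q = (P *m Z *m P + Q) *m (Y + Q) *m (P *m Z *m P + Q)^T.
  move=> PX PY defX; rewrite tE.
  have QY : Q *m Y = 0 by rewrite PY !mulmxA QP !mul0mx.
  have YQ : Y *m Q = 0 by rewrite PY -!mulmxA PQ !mulmx0.
  have EQ : P *m Z *m P *m Q = 0 by rewrite -!mulmxA PQ !mulmx0.
  have QF : Q *m (P *m Z^T *m P) = 0 by rewrite !mulmxA QP !mul0mx.
  have -> : (P *m Z *m P + Q) *m (Y + Q) = P *m Z *m P *m Y + Q.
    by rewrite mulmxDl !mulmxDr EQ QY QQ addr0 add0r.
  rewrite mulmxDl !mulmxDr QF QQ add0r.
  rewrite -[_ *m Y *m Q]mulmxA YQ mulmx0 addr0; congr (_ + _).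
  by rewrite {1}PX defX {1}PY !mulmxA.
have cutL := cut _ _ _ PL PM defL0; have cutM := cut _ _ _ PM PL defM0.
set A1 := P *m A0 *m P + Q in cutL; set B1 := P *m B0 *m P + Q in cutM.
have B1u : B1 \in unitmx.
  (* [A1 *m B1] is an isometry of the nondegenerate [L0 + Q], hence unimodular, and so is its right
     factor. *)
  apply: (@unitmx_mulr _ _ A1); apply: (unitmx_isometry (R := int) (L := L0 + Q)) => //.
    exact: intr_inj.
  rewrite (_ : map_mx intr _ = A1 *m B1); last by apply/matrixP=> i j; rewrite mxE intz.
  by rewrite {1}cutL cutM trmx_mul !mulmxA.
exists (invmx W *m B1 *m U).
  by rewrite !unitmx_mul unitmx_inv Wu B1u.
have defM1 : M0 = B1 *m L0 *m B1^T.
  apply: (addIr Q); rewrite cutM mulmxDr mulmxDl; congr (_ + _).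
  rewrite /B1 tE mulmxDl -!mulmxA PQ !mulmx0 add0r QQ.
  by rewrite mulmxDr !mulmxA QP !mul0mx add0r QQ.
rewrite -[LHS](conjK W) // -/M0 defM1 /L0 !trmx_mul !mulmxA //.
Qed.

(** * Forms with independent entries, and the three cases together *)

Definition zfree (k : fieldType) (r : nat) (b : 'I_r -> k) :=
  forall z : 'I_r -> int, \sum_(l < r) b l *~ z l = 0 -> forall l, z l = 0.

(** Freeness of [b] makes the transition matrices satisfy [ZZ *m WW = 1]. They are square, so [WW]
    is invertible on both sides, and a relation among the [g m], being a row vector killed by [WW],
    is zero. *)
Lemma zfree_of_generates_basis (k : fieldType) (r : nat) (b g : 'I_r -> k) :
  zfree b ->
  (forall l, exists z : 'I_r -> int, b l = \sum_(m < r) g m *~ z m) ->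
  (forall m, exists z : 'I_r -> int, g m = \sum_(l < r) b l *~ z l) ->
  zfree g.
Proof.
move=> freeb /fin_all_exists[Z bZ] /fin_all_exists[W gW].
pose ZZ : 'M[int]_r := \matrix_(i, j) Z i j;
  pose WW : 'M[int]_r := \matrix_(i, j) W i j.
have comb (z : 'I_r -> int) : \sum_m g m *~ z m =
    \sum_l b l *~ (\sum_m z m * W m l).
  under eq_bigr => m _ do rewrite gW -mulrzl mulr_sumr.
  rewrite exchange_big; apply: eq_bigr => l _ /=.
  rewrite -mulrzr rmorph_sum mulr_sumr; apply: eq_bigr => m _.
  by rewrite mulrzl -mulrzA mulrC mulrzr.
have ZW1 : ZZ *m WW = 1%:M.
  apply/matrixP => i j; rewrite !mxE; apply/eqP; rewrite -subr_eq0; apply/eqP.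
  pose y l := \sum_m Z i m * W m l - (i == l)%:R.
  rewrite -[LHS]/(\sum_m ZZ i m * WW m j - (i == j)%:R).
  transitivity (y j); first by congr (_ - _); apply: eq_bigr => m _; rewrite !mxE.
  apply: freeb; under eq_bigr => l _ do rewrite mulrzBr.
  rewrite sumrB -comb -bZ (bigD1 i) //= eqxx big1 ?addr0 ?subrr // => l li.
  by rewrite eq_sym (negbTE li).
move=> z; rewrite comb => /freeb zW0 l.
have zWW : (\row_m z m) *m WW = 0.
  apply/rowP => j; rewrite !mxE -[RHS](zW0 j); apply: eq_bigr => m _; rewrite !mxE //.
have := congr1 (fun v : 'rV_r => v 0 l) (congr1 (mulmx^~ ZZ) zWW).
by rewrite /= -mulmxA (mulmx1C ZW1) mulmx1 mul0mx !mxE.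
Qed.

Lemma card_ltn_pairs n :
  #|[set p : 'I_n * 'I_n | (p.1 < p.2)%N]| = ((n * (n - 1)) %/ 2)%N.
Proof.
rewrite -sum1dep_card -(pair_big_dep xpredT (fun i j : 'I_n => i < j)%N (fun _ _ =>
  1%N)) /=.
rewrite (exchange_big_dep xpredT) //= subn1 divn2 -bin2 -bin2_sum big_mkord.
apply: eq_bigr => j _; rewrite sum1dep_card.
rewrite -[RHS](card_ord j) -(card_image (f := widen_ord (ltnW (ltn_ord j)))).
  apply: eq_card => i; rewrite !inE; apply/idP/imageP => [lt_ij | [l _ ->]] /=;
    last exact: ltn_ord.
  by exists (Ordinal lt_ij) => //; apply: val_inj.
by move=> x y /(congr1 val) /= /val_inj.
Qed.

Lemma entry_subgroupP (k : fieldType) n (lam : 'M[k]_n) i j :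
  entry_subgroup lam (lam i j).
Proof.
exists (fun a b => ((a == i) && (b == j))%:R).
rewrite (bigD1 i) //= (bigD1 j) //= !eqxx big1 ?big1 ?addr0 //.
  by move=> a /negbTE ->; rewrite big1.
by move=> b /negbTE ->; rewrite andbF.
Qed.

Lemma antisym_diag (k : fieldType) n (lam : 'M[k]_n) i :
  [pchar k] =i pred0 -> antisym lam -> lam i i = 0.
Proof.
move=> /pcharf0P char0 /matrixP/(_ i i); rewrite !mxE => /eqP.
rewrite -addr_eq0 -mulr2n -mulr_natr mulf_eq0 (char0 2) orbF => /eqP //.
Qed.

(** The terms at [(i, j)] and [(j, i)] are paired and the diagonal vanishes. With
    [F a b = D p a * D q b] the coefficients become 2x2 minors of [D]. *)
Lemma antisym_sum_ltn (k : fieldType) n (lam : 'M[k]_n) (F : 'I_n -> 'I_n -> int) :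
  [pchar k] =i pred0 -> antisym lam ->
  \sum_i \sum_j lam i j *~ F i j =
  \sum_(p in [set p : 'I_n * 'I_n | (p.1 < p.2)%N])
     lam p.1 p.2 *~ (F p.1 p.2 - F p.2 p.1).
Proof.
move=> char0 skew; rewrite pair_big /=.
under [RHS]eq_bigr => p _ do rewrite mulrzBr.
rewrite sumrB /= (bigID (fun p : 'I_n * 'I_n => p.1 < p.2)%N) /=.
congr (_ + _); first by apply: eq_bigl => p; rewrite inE.
rewrite (bigID (fun p : 'I_n * 'I_n => p.1 == p.2)) /= big1 ?add0r; last first.
  by case=> i j /andP[_ /= /eqP->]; rewrite antisym_diag ?mul0rz.
pose sw (p : 'I_n * 'I_n) := (p.2, p.1).
rewrite (reindex_inj (h := sw)) /=; last by case=> ? ? [? ?] [-> ->].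
rewrite -sumrN; apply: eq_big => [[i j]|[i j] _] /=.
  by rewrite inE /= -leqNgt andbC ltn_neqAle eq_sym.
by have /matrixP/(_ i j) := skew; rewrite !mxE => ->; rewrite mulNrz.
Qed.

(* With independent entries the second compound matrix of C is the identity,
   and a column of an inverse of C can be read off from its 2x2 minors. *)
Lemma unitmx_isometry_zfree (k : fieldType) n (lam : 'M[k]_n) (C : 'M[int]_n) :
  [pchar k] =i pred0 -> antisym lam -> (1 < n)%N ->
  free_abelian_rank (entry_subgroup lam) ((n * (n - 1)) %/ 2) ->
  lam = intmx k C *m lam *m (intmx k C)^T -> C \in unitmx.
Proof.
move=> char0 skew n_gt1; rewrite -card_ltn_pairs; set T := [set p | _].
move=> [b [freeb genb]] defl.
(* The entries above the diagonal generate the entry subgroup and are as many as its rank, so they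
   are themselves independent. *)
pose g (t : 'I_#|T|) := lam (enum_val t).1 (enum_val t).2.
have freeg : zfree g.
  apply: (zfree_of_generates_basis freeb) => l; last first.
    by apply/genb; apply: entry_subgroupP.
  have [m ->] : entry_subgroup lam (b l).
    apply/genb; exists (fun l' => (l' == l)%:R); rewrite (bigD1 l) //= eqxx.
    by rewrite big1 ?addr0 // => m /negbTE->.
  rewrite antisym_sum_ltn // big_enum_val.
  by exists (fun t => m (enum_val t).1 (enum_val t).2 - m (enum_val t).2 (enum_val
    t).1).
have expand (D : 'M[int]_n) p q : (intmx k D *m lam *m (intmx k D)^T) p q =
    \sum_(t < #|T|) g t *~ (D p (enum_val t).1 * D q (enum_val t).2
                          - D p (enum_val t).2 * D q (enum_val t).1).
  rewrite -(big_enum_val (fun u : 'I_n * 'I_n => lam u.1 u.2 *~ (D p u.1 * D q u.2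
    - D p u.2 * D q u.1))).
  rewrite -(antisym_sum_ltn (fun a b => D p a * D q b)) // !mxE exchange_big /=.
  apply: eq_bigr => j _; rewrite !mxE mulr_suml; apply: eq_bigr => i _.
  by rewrite !mxE -[RHS]mulrzr intrM -mulrA mulrCA mulrA.
(* The two expansions of [lam], through [C] and through the identity, must have equal coefficients,
   which are the minors. *)
have minorE p q a c : a != c ->
    C p a * C q c - C p c * C q a = (p == a)%:R * (q == c)%:R - (p == c)%:R * (q ==
      a)%:R.
  wlog lt_ac : a c / (a < c)%N => [hw ac | _].
    have [/hw->//|] := ltnP a c;
      rewrite leq_eqVlt eq_sym (inj_eq val_inj) (negbTE ac) /=.
    by move=> /hw; rewrite eq_sym => /(_ ac) hca; rewrite -opprB hca opprB.
  have acT : (a, c) \in T by rewrite inE.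
  apply/eqP; rewrite -subr_eq0; apply/eqP.
  pose y (D : 'M[int]_n) (u : 'I_n * 'I_n) := D p u.1 * D q u.2 - D p u.2 * D q u.1.
  have -> : (p == a)%:R * (q == c)%:R - (p == c)%:R * (q == a)%:R = y 1%:M (a, c).
    by rewrite /y !mxE.
  rewrite -[LHS]/(y C (a, c) - y 1%:M (a, c)).
  rewrite -(enum_rankK_in acT acT); set t := enum_rank_in _ _.
  apply: (freeg (fun t => y C (enum_val t) - y 1%:M (enum_val t))).
  under eq_bigr => l _ do rewrite mulrzBr.
  rewrite sumrB -!expand -defl (_ : intmx k 1%:M = 1%:M) ?trmx1 ?mulmx1 ?mul1mx
    ?subrr //.
  by rewrite /intmx -[RHS](map_mx1 intr).
have [d dP] : exists d : 'I_n -> 'I_n, forall a, a != d a.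
  case: n n_gt1 {lam C skew T b freeb genb defl g freeg expand minorE} => [|[|n]] // _.
  by exists (fun a => if a == ord0 then ord_max else ord0) => a;
    have [->|] := eqVneq a ord0.
(* The entry of [C *m X] at [(q, a)] is the minor of [C] on rows [q], [d a] and columns [a], [d a];
   any [d] without fixed points serves. *)
pose X := \matrix_(p, a) ((p == a)%:R * C (d a) (d a) - (p == d a)%:R * C (d a) a).
suff CX : C *m X = 1%:M by have [] := mulmx1_unit CX.
apply/matrixP => q a; rewrite !mxE.
under eq_bigr => p _ do rewrite mxE mulrBr !mulrA.
rewrite sumrB -!mulr_suml (bigD1 a) //= eqxx mulr1 big1 ?addr0; last first.
  by move=> p /negbTE->; rewrite mulr0.
rewrite (bigD1 (d a)) //= eqxx mulr1 big1 ?addr0; last first.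
  by move=> p /negbTE->; rewrite mulr0.
rewrite minorE // eqxx [d a == a]eq_sym (negbTE (dP a)) mulr0 subr0 mulr1 //.
Qed.

Lemma congruence_of_mutual (k : fieldType) n (lam mu : 'M[k]_n) (A B : 'M[int]_n) :
  [pchar k] =i pred0 -> antisym lam ->
  [\/ lam \in unitmx,
      cyclic_subgroup (entry_subgroup lam)
    | free_abelian_rank (entry_subgroup lam) ((n * (n - 1)) %/ 2)] ->
  lam = intmx k A *m mu *m (intmx k A)^T ->
  mu = intmx k B *m lam *m (intmx k B)^T ->
  exists C : 'M[int]_n, C \in unitmx /\ mu = intmx k C *m lam *m (intmx k C)^T.
Proof.
move=> char0 skew hyp defl defm; have intrI := intr_inj_pchar0 char0.
have defAB : lam = intmx k (A *m B) *m lam *m (intmx k (A *m B))^T.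
  by rewrite {1}defl defm /intmx map_mxM trmx_mul !mulmxA.
have trivial0 : lam = 0 -> exists C : 'M[int]_n,
    C \in unitmx /\ mu = intmx k C *m lam *m (intmx k C)^T.
  move=> lam0; exists 1%:M; rewrite unitmx1; split => //.
  by rewrite defm lam0 !mulmx0 !mul0mx.
case: hyp => [ul | [c cG] | freeG].
- exists B; split=> //; apply: (@unitmx_mulr _ _ A).
  by apply: (unitmx_isometry intrI (L := lam)) => //; rewrite -unitfE -unitmxE.
(* For a zero generator [lam] vanishes. Otherwise [c] can be cancelled, and both congruences descend
   to integer matrices [L] and [M]. *)
- have [c0 | nzc] := eqVneq c 0.
    apply: trivial0; apply/matrixP => i j; rewrite mxE.
    by have /cG[z ->] := entry_subgroupP lam i j; rewrite c0 mul0rz.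
  have /fin_all_exists[z lamz] (p : 'I_n * 'I_n) : exists z : int, lam p.1 p.2 = c *~ z.
    by apply/cG; apply: entry_subgroupP.
  pose L : 'M[int]_n := \matrix_(i, j) z (i, j).
  have lamL : lam = c *: intmx k L.
    by apply/matrixP => i j; rewrite !mxE (lamz (i, j)) mulrzr.
  have intmxI : injective (intmx k (n := n)).
    by move=> X Y /matrixP XY; apply/matrixP => i j; have := XY i j;
      rewrite !mxE => /intrI.
  pose M := B *m L *m B^T.
  have muM : mu = c *: intmx k M.
    by rewrite defm lamL /intmx !map_mxM map_trmx -scalemxAr -scalemxAl.
  have defL : L = A *m M *m A^T.
    apply: intmxI; apply: (scalerI nzc); rewrite -lamL {1}defl muM.
    by rewrite /intmx !map_mxM map_trmx -scalemxAr -scalemxAl.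
  have skewL : L^T = - L.
    apply: intmxI; apply: (scalerI nzc).
    rewrite /intmx raddfN scalerN -map_trmx -[map_mx _ L]/(intmx k L) -lamL -skew.
    by rewrite lamL linearZ.
  have [C Cu defM] := congruence_of_mutual_int skewL defL erefl.
  exists C; split=> //; rewrite muM lamL -/M defM.
  by rewrite /intmx !map_mxM map_trmx -scalemxAr -scalemxAl.
(* The argument by minors uses two distinct indices; for [n <= 1] antisymmetry leaves only the zero
   matrix. *)
have [n_gt1 | n_le1] := ltnP 1 n.
  exists B; split=> //; apply: (@unitmx_mulr _ _ A).
  exact: (unitmx_isometry_zfree char0 skew n_gt1 freeG defAB).
apply: trivial0; apply/matrixP => i j; rewrite mxE (_ : j = i) ?antisym_diag //.
by apply: val_inj; case: n n_le1 i j {lam mu A B skew freeG defl defm defAB} =>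
  [|[|n]] // _;
  [case | move=> i j; rewrite !ord1].
Qed.

(** * Derivations of the field of rational functions *)

Lemma fraction_repr (R : idomainType) (x : {fraction R}) :
  x = tofrac (frac (repr x)).1 / tofrac (frac (repr x)).2.
Proof.
set y := repr x; have nzd : tofrac (frac y).2 != 0 by rewrite tofrac_eq0;
  apply: denom_ratioP.
rewrite -[LHS](mulfK nzd); congr (_ / _).
rewrite -{1}[x]reprK -/y; unlock tofrac; rewrite -[LHS]FracField.pi_mul.
apply/eqmodP => /=; rewrite FracField.equivfE /FracField.mulf.
by rewrite !numden_Ratio ?mulf_neq0 ?oner_eq0 ?denom_ratioP // !mulr1 mulrC.
Qed.

Lemma fraction_ind (R : idomainType) (P : {fraction R} -> Prop) :
  (forall a b : R, b != 0 -> P (tofrac a / tofrac b)) -> forall x, P x.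
Proof. by move=> hP x; rewrite (fraction_repr x); apply: hP; apply: denom_ratioP. Qed.

Lemma fraction_eq_mul (R : idomainType) (a b c d : R) : b != 0 -> d != 0 ->
  tofrac a / tofrac b = tofrac c / tofrac d <-> a * d = c * b.
Proof.
move=> nzb nzd; split=> [/eqP | eq_ad].
  by rewrite eqr_div ?tofrac_eq0 // -!tofracM tofrac_eq => /eqP.
by apply/eqP; rewrite eqr_div ?tofrac_eq0 // -!tofracM tofrac_eq eq_ad.
Qed.

Lemma rderiv_frac (k : fieldType) n (i : 'I_n) (a b : {mpoly k[n]}) : b != 0 ->
  rderiv i (tofrac a / tofrac b) =
  tofrac (mderiv i a * b - a * mderiv i b) / tofrac (b * b).
Proof.
move=> nzb; rewrite /rderiv; set f := tofrac a / tofrac b; set r := repr f.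
set a0 := (frac r).1; set b0 := (frac r).2.
have nzb0 : b0 != 0 by apply: denom_ratioP.
have /fraction_eq_mul-/(_ nzb nzb0) e1 : f = tofrac a0 / tofrac b0 by apply:
  fraction_repr.
have := congr1 (mderiv i) e1; rewrite !mderivM => e2.
apply/fraction_eq_mul; rewrite ?mulf_neq0 //.
move: (a^`M(i)) (b^`M(i)) (a0^`M(i)) (b0^`M(i)) e2 => a' b' a0' b0' e2.
(* The right-hand side is arranged to contain [a0 * b] and its derivative, which [e1] and [e2] then
   express through [a] and [b0]. *)
have -> : (a0' * b0 - a0 * b0') * (b * b) =
  (a0' * b + a0 * b') * (b * b0) - (a0 * b) * (b' * b0 + b0' * b) by ring.
by rewrite -e1 -e2; ring.
Qed.

Record derivation (F : fieldType) (D : F -> F) : Prop := Derivation {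
  derivationD : {morph D : x y / x + y};
  derivationM : forall x y, D (x * y) = D x * y + x * D y }.

Section Derivation.
Variables (F : fieldType) (D : F -> F).
Hypothesis derD : derivation D.
Let DD := derivationD derD.
Let DM := derivationM derD.

Lemma derivation1 : D 1 = 0.
Proof. by apply: (addrI (D 1)); rewrite addr0 -{3}[1]mulr1 DM mulr1 mul1r. Qed.

Lemma derivation0 : D 0 = 0.
Proof. by apply: (addrI (D 0)); rewrite -DD !addr0. Qed.

Lemma derivation_div x y : y != 0 -> D (x / y) = (D x * y - x * D y) / (y * y).
Proof.
move=> nzy; have := DM (x / y) y; rewrite divfK // => ->.
by field; rewrite nzy.
Qed.

Lemma logderM x y : x != 0 -> y != 0 -> D (x * y) / (x * y) = D x / x + D y / y.
Proof. by move=> nzx nzy; rewrite DM; field; rewrite nzx nzy. Qed.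

Lemma logder_div x y : x != 0 -> y != 0 -> D (x / y) / (x / y) = D x / x - D y / y.
Proof. by move=> nzx nzy; rewrite derivation_div //; field; rewrite nzx nzy. Qed.

Lemma logderXn x m : x != 0 -> D (x ^+ m) / x ^+ m = (D x / x) *+ m.
Proof.
move=> nzx; elim: m => [|m IHm]; first by rewrite derivation1 mul0r.
by rewrite exprS logderM ?expf_neq0 // IHm mulrS.
Qed.

Lemma logderXz x (z : int) : x != 0 -> D (x ^ z) / x ^ z = (D x / x) *~ z.
Proof.
move=> nzx; case: z => m; first exact: logderXn.
rewrite NegzE -invr_expz -div1r logder_div ?oner_eq0 ?expfz_neq0 //.
by rewrite derivation1 mul0r sub0r logderXn // mulrNz.
Qed.

Lemma logder_prod (I : Type) (r : seq I) (G : I -> F) : (forall i, G i != 0) ->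
  D (\prod_(i <- r) G i) / \prod_(i <- r) G i = \sum_(i <- r) D (G i) / G i.
Proof.
move=> nzG; elim: r => [|i r IHr]; first by rewrite !big_nil derivation1 mul0r.
rewrite !big_cons logderM // ?IHr //.
by apply: (big_ind (fun x => x != 0)) => //; [apply: oner_neq0 | apply: mulf_neq0].
Qed.

End Derivation.

Lemma quotient_ruleD (F : fieldType) (a b c d a' b' c' d' : F) :
  b != 0 -> d != 0 ->
  ((a' * d + a * d' + (c' * b + c * b')) * (b * d)
     - (a * d + c * b) * (b' * d + b * d')) / ((b * d) * (b * d)) =
  (a' * b - a * b') / (b * b) + (c' * d - c * d') / (d * d).
Proof. by move=> nzb nzd; field; rewrite nzb nzd. Qed.

Lemma quotient_ruleM (F : fieldType) (a b c d a' b' c' d' : F) :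
  b != 0 -> d != 0 ->
  ((a' * c + a * c') * (b * d) - (a * c) * (b' * d + b * d'))
    / ((b * d) * (b * d)) =
  (a' * b - a * b') / (b * b) * (c / d) + a / b * ((c' * d - c * d') / (d * d)).
Proof. by move=> nzb nzd; field; rewrite nzb nzd. Qed.

Lemma rderiv_derivation (k : fieldType) n (i : 'I_n) : derivation (@rderiv k n i).
Proof.
split; elim/fraction_ind => a b nzb; elim/fraction_ind => c d nzd.
  have -> : tofrac a / tofrac b + tofrac c / tofrac d =
      tofrac (a * d + c * b) / tofrac (b * d).
    by rewrite addf_div ?tofrac_eq0 // tofracD !tofracM.
  rewrite !rderiv_frac ?mulf_neq0 // mderivD !mderivM.
  by rewrite !(tofracD, tofracN, tofracM) quotient_ruleD ?tofrac_eq0.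
rewrite mulf_div -!tofracM !rderiv_frac ?mulf_neq0 // !mderivM.
by rewrite !(tofracD, tofracN, tofracM) quotient_ruleM ?tofrac_eq0.
Qed.

(** * Euler operators and the bracket *)

Definition reuler (k : fieldType) n (i : 'I_n) (f : ratfun k n) : ratfun k n :=
  @rvar k n i * rderiv i f.

Definition meuler (k : fieldType) n (i : 'I_n) (p : {mpoly k[n]}) : {mpoly k[n]} :=
  'X_i * mderiv i p.

Lemma reuler_derivation (k : fieldType) n (i : 'I_n) : derivation (@reuler k n i).
Proof.
have [rD rM] := @rderiv_derivation k n i.
split=> x y; rewrite /reuler; first by rewrite rD mulrDr.
by rewrite rM mulrDr mulrA [X in _ + X]mulrCA.
Qed.

(** In terms of Euler operators the bracket has constant coefficients; both the residue computation
    and the change of variables rely on this form. *)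
Lemma pbracketE (k : fieldType) n (lam : 'M[k]_n) (f g : ratfun k n) :
  pbracket lam f g =
  \sum_i \sum_j @rconst k n (lam i j) * reuler i f * reuler j g.
Proof.
apply: eq_bigr => i _; apply: eq_bigr => j _; rewrite /reuler.
move: (rderiv i f) (rderiv j g) => u v.
by rewrite !mulrA; congr (_ * _); rewrite -!mulrA; congr (_ * (_ * _)); apply: mulrC.
Qed.

Lemma reuler_tofrac (k : fieldType) n (i : 'I_n) (p : {mpoly k[n]}) :
  reuler i (tofrac p) = tofrac (meuler i p).
Proof.
rewrite /reuler -[tofrac p]divr1 -tofrac1 rderiv_frac ?oner_eq0 //.
by rewrite mderivC mulr0 subr0 !mulr1 tofrac1 divr1 tofracM.
Qed.

Lemma meulerX (k : fieldType) n (i : 'I_n) (m : 'X_{1..n}) :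
  meuler i 'X_[k, m] = (m i)%:R *: 'X_[m].
Proof.
rewrite /meuler mderivX; have [->|nz] := eqVneq (m i) 0%N.
  by rewrite !scale0r mulr0.
by rewrite -scalerAr -mpolyXD addmC submK // lep1mP.
Qed.

Lemma meulerZD (k : fieldType) n (i : 'I_n) c (p q : {mpoly k[n]}) :
  meuler i (c *: p + q) = c *: meuler i p + meuler i q.
Proof. by rewrite /meuler mderivD mderivZ mulrDr scalerAr. Qed.

Lemma mcoeff_meuler (k : fieldType) n (i : 'I_n) (p : {mpoly k[n]}) m :
  (meuler i p)@_m = (m i)%:R * p@_m.
Proof.
elim/mpolyind: p => [|c m' p _ _ IHp];
  first by rewrite /meuler mderiv0 mulr0 !mcoeff0 mulr0.
rewrite meulerZD !mcoeffD !mcoeffZ IHp meulerX mcoeffZ mcoeffX mulrDr.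
by case: eqP => [->|_]; rewrite ?mulr0 // !mulr1; congr (_ + _); rewrite mulrC.
Qed.

Lemma rconstM (k : fieldType) n (c d : k) : @rconst k n (c * d) = rconst n c *
  rconst n d.
Proof. by rewrite /rconst mpolyCM tofracM. Qed.

Lemma rconstD (k : fieldType) n (c d : k) : @rconst k n (c + d) = rconst n c +
  rconst n d.
Proof. by rewrite /rconst mpolyCD tofracD. Qed.

Lemma rconstB (k : fieldType) n (c d : k) : @rconst k n (c - d) = rconst n c -
  rconst n d.
Proof. by rewrite /rconst mpolyCB tofracB. Qed.

Lemma rconst0 (k : fieldType) n : @rconst k n 0 = 0.
Proof. by rewrite /rconst mpolyC0 tofrac0. Qed.

Lemma rvar_neq0 (k : fieldType) n (i : 'I_n) : @rvar k n i != 0.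
Proof. by rewrite tofrac_eq0 -msupp_eq0 msuppX. Qed.

Lemma reuler_rvar (k : fieldType) n (i j : 'I_n) :
  reuler i (@rvar k n j) = (i == j)%:R * @rvar k n j.
Proof.
rewrite reuler_tofrac meulerX mnm1E eq_sym; case: eqP => _.
  by rewrite scale1r mul1r.
by rewrite scale0r mul0r tofrac0.
Qed.

Lemma pbracket_rvar (k : fieldType) n (lam : 'M[k]_n) (i j : 'I_n) :
  pbracket lam (rvar k i) (rvar k j) = rconst n (lam i j) * rvar k i * rvar k j.
Proof.
rewrite pbracketE (bigD1 i) //= (bigD1 j) //= !reuler_rvar !eqxx !mul1r.
rewrite big1 ?addr0; last by move=> l /negbTE jl; rewrite !reuler_rvar jl mul0r mulr0.
rewrite big1 ?addr0 // => l /negbTE il; rewrite big1 // => m _.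
by rewrite !reuler_rvar il mul0r mulr0 mul0r.
Qed.

(** * Residues of logarithmic derivatives *)

(* The maximal ideal of the valuation ring attached to leading monomials. *)
Definition infinitesimal (k : fieldType) n (f : ratfun k n) : Prop :=
  exists p q : {mpoly k[n]}, [/\ q != 0, f = tofrac p / tofrac q
    & {in msupp p, forall m, (m < mlead q)%O}].

Section Infinitesimal.
Variables (k : fieldType) (n : nat).
Implicit Types (f g : ratfun k n) (c d : k).

(** Leading monomials multiply and the monomial order is compatible with products, so over the
    common denominator each numerator term stays strictly below the leading monomial. *)
Lemma infinitesimalD f g :
  infinitesimal f -> infinitesimal g -> infinitesimal (f + g).
Proof.
move=> [p [q [nzq -> ltp]]] [p' [q' [nzq' -> ltp']]].
exists (p * q' + p' * q), (q * q'); split; first exact: mulf_neq0.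
  by rewrite addf_div ?tofrac_eq0 // tofracD !tofracM.
move=> m /msuppD_le; rewrite mem_cat mleadM //.
case/orP => /msuppM_le/allpairsP[[m1 m2] /= [m1p m2p ->]].
  by apply: ltmc_le_add; [apply: ltp | apply: msupp_le_mlead].
by rewrite addmC; apply: lemc_lt_add; [apply: msupp_le_mlead | apply: ltp'].
Qed.

Lemma infinitesimalM f g :
  infinitesimal f -> infinitesimal g -> infinitesimal (f * g).
Proof.
move=> [p [q [nzq -> ltp]]] [p' [q' [nzq' -> ltp']]].
exists (p * p'), (q * q'); split; first exact: mulf_neq0.
  by rewrite mulf_div !tofracM.
move=> m /msuppM_le/allpairsP[[m1 m2] /= [m1p m2p ->]]; rewrite mleadM //.
by apply: ltm_add; [apply: ltp | apply: ltp'].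
Qed.

Lemma infinitesimalZ c f : infinitesimal f -> infinitesimal (rconst n c * f).
Proof.
move=> [p [q [nzq -> ltp]]]; exists (c%:MP * p), q; split=> //.
  by rewrite tofracM mulrA.
by move=> m; rewrite mul_mpolyC => /msuppZ_le/ltp.
Qed.

(** For [c] nonzero the numerator [c *: q] would contain the leading monomial of [q], which must be
    strictly larger than all its terms. *)
Lemma infinitesimal_const c : infinitesimal (rconst n c) -> c = 0.
Proof.
move=> [p [q [nzq defc ltp]]]; apply/eqP/negP => /negP nzc.
have nzqF : tofrac q != 0 by rewrite tofrac_eq0.
have defp : p = c *: q.
  apply/eqP; rewrite -tofrac_eq -mul_mpolyC tofracM; apply/eqP.
  by rewrite -[LHS](divfK nzqF) -defc.
suff /ltp : mlead q \in msupp p by rewrite ltxx.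
by rewrite defp mcoeff_msupp mcoeffZ mulf_neq0 ?mleadc_eq0.
Qed.

Lemma infinitesimal0 : infinitesimal (0 : ratfun k n).
Proof.
exists 0, 1; split; rewrite ?oner_eq0 ?tofrac0 ?mul0r //.
by move=> m; rewrite msupp0.
Qed.

(** A relation rather than a function, since elements outside the valuation ring have no residue. *)
Definition residue f c := infinitesimal (f - rconst n c).

Lemma residueD f g c d : residue f c -> residue g d -> residue (f + g) (c + d).
Proof.
by move=> rf rg; rewrite /residue rconstD opprD addrACA; apply: infinitesimalD.
Qed.

Lemma residueM f g c d : residue f c -> residue g d -> residue (f * g) (c * d).
Proof.
move=> rf rg; rewrite /residue.
have -> : f * g - rconst n (c * d) = (f - rconst n c) * (g - rconst n d)
    + (rconst n c * (g - rconst n d) + rconst n d * (f - rconst n c)).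
  have expand (F : fieldType) (x y z t : F) :
    x * y - z * t = (x - z) * (y - t) + (z * (y - t) + t * (x - z)) by ring.
  by rewrite rconstM; apply: expand.
by apply: infinitesimalD; [apply: infinitesimalM | apply: infinitesimalD;
  apply: infinitesimalZ].
Qed.

Lemma residue_const c : residue (rconst n c) c.
Proof. by rewrite /residue subrr; apply: infinitesimal0. Qed.

Lemma residue_sum (I : Type) (r : seq I) (F : I -> ratfun k n) (c : I -> k) :
  (forall i, residue (F i) (c i)) -> residue (\sum_(i <- r) F i) (\sum_(i <- r) c i).
Proof.
move=> rF; elim: r => [|i r IHr]; last by rewrite !big_cons; apply: residueD.
by rewrite !big_nil -(rconst0 k n); apply: residue_const.
Qed.

Lemma residue_unique c d : residue (rconst n c) d -> c = d.
Proof.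
by rewrite /residue -rconstB => /infinitesimal_const/eqP; rewrite subr_eq0 => /eqP.
Qed.

(** Monomials are eigenvectors of the Euler operator, so subtracting [(mlead p l)%:R *: p] removes
    the leading term and adds no new monomial. *)
Lemma residue_logder_poly (l : 'I_n) (p : {mpoly k[n]}) : p != 0 ->
  residue (reuler l (tofrac p) / tofrac p) (mlead p l)%:R.
Proof.
move=> nzp; exists (meuler l p - (mlead p l)%:R *: p), p; split=> //.
  rewrite reuler_tofrac tofracB mulrBl -mul_mpolyC [tofrac (_%:MP * p)]tofracM mulfK //.
  by rewrite tofrac_eq0.
move=> m; rewrite mcoeff_msupp mcoeffB mcoeffZ mcoeff_meuler -mulrBl.
have [-> | ne_m] := eqVneq m (mlead p); first by rewrite subrr mul0r eqxx.
rewrite mulf_eq0 negb_or => /andP[_ pm].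
by rewrite lt_neqAle ne_m msupp_le_mlead // mcoeff_msupp.
Qed.

Lemma residue_logder (f : ratfun k n) : f != 0 ->
  exists v : 'I_n -> int, forall l, residue (reuler l f / f) (v l)%:~R.
Proof.
elim/fraction_ind: f => a b nzb nzf.
have nza : a != 0 by apply: contraNneq nzf => ->; rewrite tofrac0 mul0r.
exists (fun l => (mlead a l)%:Z - (mlead b l)%:Z) => l.
rewrite (logder_div (reuler_derivation k l)) ?tofrac_eq0 // rmorphB /=.
have := residueD (residue_logder_poly l nza)
  (residueM (residue_const (-1)) (residue_logder_poly l nzb)).
by rewrite mulN1r /rconst mpolyCN mpolyC1 tofracN tofrac1 mulN1r.
Qed.

End Infinitesimal.

Lemma congruence_of_log_canonical (k : fieldType) n (lam mu : 'M[k]_n)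
    (y : 'I_n -> ratfun k n) :
  (forall i, y i != 0) ->
  (forall i j, pbracket mu (y i) (y j) = rconst n (lam i j) * y i * y j) ->
  exists A : 'M[int]_n, lam = intmx k A *m mu *m (intmx k A)^T.
Proof.
move=> nzy bry.
have /fin_all_exists[v vP] i := residue_logder (nzy i).
exists (\matrix_(i, l) v i l); apply/matrixP => i j.
apply: (@residue_unique k n).
(* The bracket relation divided by [y i * y j] expresses a constant by logarithmic derivatives,
   whose residues are the exponents [v]. *)
have -> : rconst n (lam i j) = \sum_l \sum_m
    rconst n (mu m l) * (reuler m (y i) / y i) * (reuler l (y j) / y j).
  have nzij : y i * y j != 0 by rewrite mulf_neq0.
  apply: (mulIf nzij); rewrite mulrA -bry pbracketE exchange_big mulr_suml.
  apply: eq_bigr => l _; rewrite mulr_suml; apply: eq_bigr => m _.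
  move: (rconst n _) (reuler m _) (reuler l _) => c u w.
  by rewrite mulrACA (divfK (nzy j)) -[c * (u / _) * _]mulrA (divfK (nzy i)).
rewrite !mxE; apply: residue_sum => l; rewrite !mxE mulr_suml; apply: residue_sum => m.
rewrite !mxE [_ * mu m l]mulrC; apply: residueM; last exact: vP.
by apply: residueM; [apply: residue_const | apply: vP].
Qed.

(** The images of the variables under the isomorphism are log-canonical for [mu], and those under
    its inverse are log-canonical for [lam]. *)
Lemma mutual_of_poisson_iso (k : fieldType) n (lam mu : 'M[k]_n) :
  poisson_iso lam mu ->
  exists A B : 'M[int]_n, lam = intmx k A *m mu *m (intmx k A)^T /\
                          mu = intmx k B *m lam *m (intmx k B)^T.
Proof.
move=> [phi [[psi phiK psiK] phic phib]].
have [|i j|A defl] := congruence_of_log_canonical (lam := lam) (mu := mu)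
  (y := fun i => phi (rvar k i)).
- by move=> i; rewrite fmorph_eq0 rvar_neq0.
- by rewrite -phib pbracket_rvar !rmorphM /= phic.
have [|i j|B defm] := congruence_of_log_canonical (lam := mu) (mu := lam)
  (y := fun i => psi (rvar k i)).
- move=> i; apply: contra_neq (rvar_neq0 k i) => psi0.
  by rewrite -[LHS]psiK psi0 rmorph0.
- apply: (can_inj phiK).
  by rewrite phib !psiK pbracket_rvar !rmorphM /= phic !psiK.
by exists A, B.
Qed.

(** * Monomial automorphisms *)

(** Injectivity keeps images of denominators nonzero, and cross-multiplication shows that the value
    does not depend on the chosen representative. *)
Lemma fraction_lift (R : idomainType) (F : fieldType) (Phi : {rmorphism R -> F}) :
  (forall p, Phi p = 0 -> p = 0) ->
  exists phi : {rmorphism {fraction R} -> F}, forall p, phi (tofrac p) = Phi p.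
Proof.
move=> injPhi; have nzPhi p : p != 0 -> Phi p != 0 by apply: contra_neq; apply: injPhi.
pose f (x : {fraction R}) := Phi (frac (repr x)).1 / Phi (frac (repr x)).2.
have fE a b : b != 0 -> f (tofrac a / tofrac b) = Phi a / Phi b.
  move=> nzb; rewrite /f; set x := tofrac a / tofrac b.
  have nzd : (frac (repr x)).2 != 0 by apply: denom_ratioP.
  have /fraction_eq_mul-/(_ nzb nzd) e : x = _ := fraction_repr x.
  by apply/eqP; rewrite eqr_div ?nzPhi // -!rmorphM e.
have f_additive : zmod_morphism f.
  elim/fraction_ind => a b nzb; elim/fraction_ind => c d nzd.
  rewrite -mulNr -tofracN addf_div ?tofrac_eq0 // -!tofracM -tofracD.
  rewrite !fE ?mulf_neq0 // !(rmorphD, rmorphM, rmorphN) /=.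
  by rewrite -[- (Phi c / _)]mulNr addf_div ?nzPhi.
have f_multiplicative : monoid_morphism f.
  split; first by rewrite -[1]divr1 -tofrac1 fE ?oner_eq0 // rmorph1 divr1.
  elim/fraction_ind => a b nzb; elim/fraction_ind => c d nzd.
  by rewrite mulf_div -!tofracM !fE ?mulf_neq0 // !rmorphM mulf_div.
pose f_add := GRing.isZmodMorphism.Build _ _ f f_additive.
pose f_mul := GRing.isMonoidMorphism.Build _ _ f f_multiplicative.
pose phi : {rmorphism {fraction R} -> F} := HB.pack f f_add f_mul.
exists phi => p; rewrite /= -[tofrac p]divr1 -tofrac1 fE ?oner_eq0 //.
by rewrite rmorph1 divr1.
Qed.

Section MonomialChainRule.
Variables (k F : fieldType) (n : nat) (c : {rmorphism k -> F}) (h : 'I_n -> F).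
Hypothesis nzh : forall i, h i != 0.

Lemma mmap1_neq0 m : mmap1 h m != 0.
Proof. by apply/prodf_neq0 => i _; rewrite expf_neq0. Qed.

(** By linearity it suffices to treat a monomial, whose image has as logarithmic derivative the sum
    of those of the [h i] weighted by the exponents. *)
Lemma derivation_mmap (D : F -> F) (p : {mpoly k[n]}) :
  derivation D -> (forall x, D (c x) = 0) ->
  D (mmap c h p) = \sum_i D (h i) / h i * mmap c h (meuler i p).
Proof.
move=> derD Dc; elim/mpolyind: p => [|x m p _ _ IHp].
  by rewrite mmap0 derivation0 // big1 // => i _;
    rewrite /meuler mderiv0 mulr0 mmap0 mulr0.
rewrite mmapD (derivationD derD) IHp.
under [RHS]eq_bigr => i _ do rewrite meulerZD mmapD mulrDr.
rewrite big_split /=; congr (_ + _).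
rewrite mmapZ mmapX (derivationM derD) Dc mul0r add0r.
rewrite -[D _](divfK (mmap1_neq0 m)) (logder_prod derD); last by move=> i;
  rewrite expf_neq0.
rewrite mulrA mulr_sumr mulr_suml; apply: eq_bigr => i _.
rewrite (logderXn derD) // meulerX !mmapZ mmapX rmorph_nat -mulr_natr.
by move: (D (h i) / h i) (mmap1 h m) => y z; ring.
Qed.

(* The kernel is stable under the Euler operators, so in characteristic zero a
   nonzero element of it would yield a monomial in the kernel. *)
Lemma mmap_injective (D : 'I_n -> F -> F) (p : {mpoly k[n]}) :
  [pchar k] =i pred0 ->
  (forall l, derivation (D l)) -> (forall l x, D l (c x) = 0) ->
  (\matrix_(i, l) (D l (h i) / h i)) \in unitmx ->
  mmap c h p = 0 -> p = 0.
Proof.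
move=> char0 derD Dc; set e := \matrix_(_, _) _ => ue.
have [s] := ubnP (size (msupp p)); elim: s => // s IHs in p *; rewrite ltnS => sz_p p0.
(* Applying every [D l] to [mmap c h p = 0] gives a linear system in the [mmap c h (meuler i p)]
   whose matrix [e] is invertible. *)
have kerE i : mmap c h (meuler i p) = 0.
  have v0 : (\row_j mmap c h (meuler j p)) *m e = 0.
    apply/rowP => l; rewrite !mxE.
    have := derivation_mmap p (derD l) (Dc l); rewrite p0 derivation0 // => sum0.
    by rewrite [RHS]sum0; apply: eq_bigr => j _; rewrite !mxE mulrC.
  have := congr1 (fun v : 'rV_n => v 0 i) (mulmxK ue (\row_j mmap c h (meuler j p))).
  by rewrite v0 mul0mx !mxE => <-.
have [// | nzp] := eqVneq p 0.
have lead_p := mlead_supp nzp; set m := mlead p in lead_p.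
(* This combination stays in the kernel but has lost the monomial [m], so the induction on the
   support size applies. *)
have eigen i : meuler i p - (m i)%:R *: p = 0.
  apply: IHs; last by rewrite mmapB mmapZ kerE p0 mulr0 subr0.
  apply: leq_trans sz_p; set q := _ - _.
  have qE m' : q@_m' = ((m' i)%:R - (m i)%:R) * p@_m'.
    by rewrite mcoeffB mcoeffZ mcoeff_meuler mulrBl.
  have sub : {subset m :: msupp q <= msupp p}.
    move=> m'; rewrite in_cons => /predU1P[->//|]; rewrite !mcoeff_msupp qE.
    by rewrite mulf_eq0 negb_or => /andP[].
  apply: (uniq_leq_size (s1 := m :: msupp q)) => //=.
  by rewrite msupp_uniq mcoeff_msupp qE subrr mul0r eqxx.
(* In characteristic zero distinct exponents have distinct tuples of Euler eigenvalues, so a joint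
   eigenvector has a single term. *)
have pE : p = p@_m *: 'X_[m].
  apply/mpolyP => m'; rewrite mcoeffZ mcoeffX; case: eqP => [<-|ne_m];
    first by rewrite mulr1.
  rewrite mulr0; apply/eqP/negP => /negP nz_m'; case: ne_m; apply/mnmP => i.
  have := congr1 (mcoeff m') (eigen i); rewrite mcoeff0 mcoeffB mcoeffZ mcoeff_meuler.
  rewrite -mulrBl => /eqP; rewrite mulf_eq0 (negbTE nz_m') orbF subr_eq0.
  have intrI := intr_inj_pchar0 char0.
  rewrite -[(m' i)%:R]/((m' i)%:Z%:~R) -[(m i)%:R]/((m i)%:Z%:~R) (inj_eq intrI).
  by move=> /eqP[].
move: p0; rewrite pE mmapZ mmapX => /eqP.
by rewrite mulf_eq0 (negbTE (mmap1_neq0 m)) orbF fmorph_eq0 => /eqP->; rewrite scale0r.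
Qed.

End MonomialChainRule.

(** On polynomials this is the chain rule for [mmap]; the quotient rule on both sides extends it to
    fractions. *)
Lemma chain_rule_ratfun (k F : fieldType) n (c : {rmorphism k -> F}) (h : 'I_n -> F)
    (phi : {rmorphism ratfun k n -> F}) (D : F -> F) (f : ratfun k n) :
  (forall i, h i != 0) -> (forall p, phi (tofrac p) = mmap c h p) ->
  derivation D -> (forall x, D (c x) = 0) ->
  D (phi f) = \sum_i D (h i) / h i * phi (reuler i f).
Proof.
move=> nzh phiE derD Dc.
have chainP p : D (phi (tofrac p)) = \sum_i D (h i) / h i * phi (reuler i (tofrac p)).
  rewrite phiE (derivation_mmap nzh p derD Dc).
  by apply: eq_bigr => i _; rewrite reuler_tofrac phiE.
elim/fraction_ind: f => a b nzb; have nzbF : tofrac b != 0 by rewrite tofrac_eq0.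
have nzpb : phi (tofrac b) != 0 by rewrite fmorph_eq0.
rewrite fmorph_div (derivation_div derD _ nzpb) !chainP.
rewrite mulr_suml mulr_sumr -sumrB mulr_suml; apply: eq_bigr => i _.
rewrite (derivation_div (reuler_derivation k i) _ nzbF).
move: (reuler i (tofrac a)) (reuler i (tofrac b)) (D (h i) / h i) => x y d.
rewrite fmorph_div rmorphB !rmorphM /=.
by rewrite [phi (tofrac a) * (d * _)]mulrCA -[d * _ * _]mulrA -mulrBr -[in LHS]mulrA.
Qed.

(** * Laurent monomial substitutions *)

Definition lmonomial (k : fieldType) n (B : 'M[int]_n) (i : 'I_n) : ratfun k n :=
  \prod_j rvar k j ^ (B i j).

Lemma lmonomial_neq0 (k : fieldType) n (B : 'M[int]_n) i : lmonomial k B i != 0.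
Proof. by apply/prodf_neq0 => j _; rewrite expfz_neq0 ?rvar_neq0. Qed.

Lemma logder_lmonomial (k : fieldType) n (B : 'M[int]_n) (i l : 'I_n) :
  reuler l (lmonomial k B i) / lmonomial k B i = (B i l)%:~R.
Proof.
have derE := reuler_derivation k l.
rewrite (logder_prod derE); last by move=> j; rewrite expfz_neq0 ?rvar_neq0.
rewrite (bigD1 l) //= (logderXz derE _ (rvar_neq0 k l)) reuler_rvar eqxx mul1r.
rewrite (divff (rvar_neq0 k l)) big1 ?addr0 // => j /negbTE jl.
by rewrite (logderXz derE _ (rvar_neq0 k j)) reuler_rvar eq_sym jl mul0r mul0r mul0rz.
Qed.

Lemma reuler_rconst (k : fieldType) n (l : 'I_n) (x : k) : reuler l (rconst n x) = 0.
Proof. by rewrite reuler_tofrac /meuler mderivC mulr0 tofrac0. Qed.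

Lemma unitmx_map_intr (R : comUnitRingType) n (B : 'M[int]_n) :
  B \in unitmx -> map_mx (intr : int -> R) B \in unitmx.
Proof.
move=> uB; have := congr1 (map_mx (intr : int -> R)) (mulmxV uB).
by rewrite map_mxM map_mx1 => /mulmx1_unit[].
Qed.

(** The logarithmic derivatives of the Laurent monomials form the matrix [B] itself. Its
    invertibility makes the substitution injective on polynomials, hence extendable to fractions. *)
Lemma monomial_morphism (k : fieldType) n (B : 'M[int]_n) :
  [pchar k] =i pred0 -> B \in unitmx ->
  exists phi : {rmorphism ratfun k n -> ratfun k n},
    [/\ forall x, phi (rconst n x) = rconst n x,
        forall i, phi (rvar k i) = lmonomial k B i
      & forall l f, reuler l (phi f) = \sum_i (B i l)%:~R * phi (reuler i f)].
Proof.
move=> char0 uB; pose c : {rmorphism k -> ratfun k n} := @tofrac _ \o @mpolyC n k.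
have nzh := @lmonomial_neq0 k n B.
have Dc l x : reuler l (c x) = 0 by apply: reuler_rconst.
have ue : (\matrix_(i, l) (reuler l (lmonomial k B i) / lmonomial k B i)) \in unitmx.
  rewrite (_ : matrix_of_fun _ _ = map_mx intr B) ?unitmx_map_intr //.
  by apply/matrixP => i l; rewrite !mxE logder_lmonomial.
have [|phi phiE] := fraction_lift (Phi := mmap c (lmonomial k B)).
  move=> p; exact: (mmap_injective nzh char0 (fun l => reuler_derivation k l) Dc ue).
exists phi; split=> [x | i | l f].
- by rewrite phiE /= mmapC.
- by rewrite phiE /= mmapX mmap1U.
rewrite (chain_rule_ratfun f nzh phiE (reuler_derivation k l) (Dc l)).
by apply: eq_bigr => i _; rewrite logder_lmonomial.
Qed.

Lemma pbracket_mx (k : fieldType) n (lam : 'M[k]_n) (f g : ratfun k n) :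
  pbracket lam f g =
  ((\row_i reuler i f) *m map_mx (rconst n) lam *m (\row_i reuler i g)^T) 0 0.
Proof.
rewrite pbracketE mxE exchange_big; apply: eq_bigr => j _; rewrite !mxE mulr_suml.
by apply: eq_bigr => i _; rewrite !mxE [_ * reuler i f]mulrC.
Qed.

Lemma ratfun_morphism_id (k : fieldType) n (phi : {rmorphism ratfun k n -> ratfun k
  n}) :
  (forall x, phi (rconst n x) = rconst n x) ->
  (forall i, phi (rvar k i) = rvar k i) -> phi =1 id.
Proof.
move=> phic phiv; have phiP p : phi (tofrac p) = tofrac p.
  rewrite [p]mpolyE !rmorph_sum; apply: eq_bigr => m _ /=.
  rewrite -mul_mpolyC !rmorphM /= phic; congr (_ * _).
  rewrite mpolyXE_id !rmorph_prod; apply: eq_bigr => i _ /=.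
  by rewrite !rmorphXn /= phiv.
by elim/fraction_ind => a b _; rewrite fmorph_div /= !phiP.
Qed.

(** Composing monomial substitutions multiplies exponent matrices, so inverse matrices give inverse
    automorphisms. *)
Lemma lmonomial_comp (k : fieldType) n (A B : 'M[int]_n) i :
  \prod_j lmonomial k B j ^ (A i j) = lmonomial k (A *m B) i.
Proof.
have expz_prod (F : fieldType) (z : int) (G : 'I_n -> F) :
    (\prod_l G l) ^ z = \prod_l G l ^ z.
  by apply: (big_morph (fun x => x ^ z)) => [x y|]; rewrite ?expfzMl ?exp1rz.
have expz_sum (F : fieldType) (x : F) (G : 'I_n -> int) : x != 0 ->
    x ^ (\sum_l G l) = \prod_l x ^ G l.
  by move=> nzx; apply: (big_morph (fun z => x ^ z)) => // y z; rewrite expfzDr.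
under eq_bigr => j _ do rewrite expz_prod.
rewrite exchange_big /=; apply: eq_bigr => l _;
  rewrite mxE (expz_sum _ _ _ (rvar_neq0 k l)).
by apply: eq_bigr => j _; rewrite exprz_exp mulrC.
Qed.

Lemma lmonomial1 (k : fieldType) n (i : 'I_n) : lmonomial k 1%:M i = rvar k i.
Proof.
rewrite /lmonomial (bigD1 i) //= mxE eqxx expr1z big1 ?mulr1 // => j.
by rewrite mxE eq_sym => /negbTE->; rewrite expr0z.
Qed.

Lemma poisson_iso_of_congruence (k : fieldType) n (lam mu : 'M[k]_n) (A : 'M[int]_n) :
  [pchar k] =i pred0 -> A \in unitmx ->
  mu = intmx k A *m lam *m (intmx k A)^T -> poisson_iso lam mu.
Proof.
move=> char0 uA defm; pose B := invmx A; have uB : B \in unitmx by rewrite unitmx_inv.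
have [phi [phic phiv phiE]] := monomial_morphism (k := k) char0 uB.
have [psi [psic psiv _]] := monomial_morphism (k := k) char0 uA.
have comp_var (C D : 'M[int]_n) (theta : {rmorphism ratfun k n -> ratfun k n}) i :
    C *m D = 1%:M -> (forall j, theta (rvar k j) = lmonomial k D j) ->
    theta (lmonomial k C i) = rvar k i.
  move=> CD1 thetav; rewrite /lmonomial rmorph_prod.
  under eq_bigr => j _ do rewrite /= fmorphXz thetav.
  by rewrite lmonomial_comp CD1 lmonomial1.
exists phi; split=> //.
  exists psi => x.
    apply: (ratfun_morphism_id (phi := psi \o phi)) => [y|i] /=;
      first by rewrite phic psic.
    by rewrite phiv; apply: comp_var psiv; rewrite mulVmx.
  apply: (ratfun_morphism_id (phi := phi \o psi)) => [y|i] /=;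
    first by rewrite psic phic.
  by rewrite psiv; apply: comp_var phiv; rewrite mulmxV.
move=> f g; pose e : 'M[ratfun k n]_n := map_mx intr B.
(* The vector of Euler derivatives transforms by the constant matrix [e], so compatibility with the
   brackets reduces to [lam = B mu B^T]. *)
have rowE x : \row_i reuler i (phi x) = map_mx phi (\row_i reuler i x) *m e.
  apply/rowP => l; rewrite !mxE phiE; apply: eq_bigr => i _.
  by rewrite !mxE mulrC.
have deflam : lam = intmx k B *m mu *m (intmx k B)^T.
  have BA1 : intmx k B *m intmx k A = 1%:M by rewrite -map_mxM mulVmx // map_mx1.
  by rewrite defm !mulmxA BA1 mul1mx -mulmxA -trmx_mul BA1 trmx1 mulmx1.
have defe : map_mx (rconst n) lam = e *m map_mx (rconst n) mu *m e^T.
  pose c : {rmorphism k -> ratfun k n} := @tofrac _ \o @mpolyC n k.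
  have eE : e = map_mx c (intmx k B) by apply/matrixP => i j; rewrite !mxE rmorph_int.
  by rewrite eE map_trmx -[rconst n]/(c : _ -> _) -!map_mxM -deflam.
have phi_lam : map_mx phi (map_mx (rconst n) lam) = map_mx (rconst n) lam.
  by apply/matrixP => i j; rewrite !mxE phic.
rewrite !pbracket_mx !rowE trmx_mul !mulmxA.
move: (\row_i reuler i f) (\row_i reuler i g) => u v.
rewrite -(mulmxA _ e) -(mulmxA _ (e *m _)) -defe -[in RHS]phi_lam map_trmx -!map_mxM.
by rewrite [RHS]mxE.
Qed.

Theorem theorem5p5 (k : fieldType) (n : nat) (lam mu : 'M[k]_n) :
  [pchar k] =i pred0 ->
  antisym lam -> antisym mu ->
  [\/ lam \in unitmx,
      cyclic_subgroup (entry_subgroup lam)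
    | free_abelian_rank (entry_subgroup lam) ((n * (n - 1)) %/ 2)] ->
  (poisson_iso lam mu <->
   exists A : 'M[int]_n, A \in unitmx /\ mu = intmx k A *m lam *m (intmx k A)^T).
Proof.
move=> char0 skl _ hyp;
  split=> [/mutual_of_poisson_iso[A [B [defl defm]]] | [A [uA defm]]].
  exact: (congruence_of_mutual char0 skl hyp defl defm).
exact: poisson_iso_of_congruence char0 uA defm.
Qed.
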